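(* For every $x \in \mathbb{R}$, \[ \int_0^x \cos(t)\,dt = \sin(x) \qquad\text{and}\qquad \int_0^x \sin(t)\,dt = 1 - \cos(x). \]
   Context: Integrals are Riemann integrals, with the convention $\int_0^x = -\int_x^0$ when $x < 0$ and $\int_0^0 = 0$. *)

(* Defs.v *)
From Stdlib Require Export Reals.
From Coquelicot Require Export Coquelicot.

(* [is_RInt f a b v] states both that [f] is Riemann integrable between [a] and
   [b] and that its integral is [v].  It is oriented: Riemann sums over
   [Rmin a b, Rmax a b] are scaled by [sign (b - a)], so the value for [b < a]
   is the opposite of the one from [b] to [a], and it is [0] for [a = b]. *)

(* Main.v *)
Require Import Defs.
From Stdlib Require Import Reals.
From Coquelicot Require Import Coquelicot.
Open Scope R_scope.

(** Both claims are the fundamental theorem of calculus, [is_RInt_derive], for continuous integrands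
    with antiderivatives [sin] and [- cos]. It holds for endpoints in either order, so the sign of
    [x] needs no case split. *)

Theorem theorem3p10 :
  forall x : R, is_RInt cos 0 x (sin x) /\ is_RInt sin 0 x (1 - cos x).
Proof.
intros x; split.
- replace (sin x) with (minus (sin x) (sin 0))
    by (rewrite sin_0; apply Rminus_0_r).
  apply (is_RInt_derive sin cos); intros t _.
  + apply is_derive_Reals, derivable_pt_lim_sin.
  + apply continuity_pt_filterlim, continuity_cos.
(* The constant 1 is the boundary term at 0 of the antiderivative [- cos], since [cos 0 = 1]. *)
- replace (1 - cos x) with (minus (- cos x) (- cos 0))
    by (rewrite cos_0; unfold minus, plus, opp; simpl; ring).
  apply (is_RInt_derive (fun t => - cos t) sin); intros t _.
  + auto_derive; [exact I | ring].
  + apply continuity_pt_filterlim, continuity_sin.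
Qed.
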